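(* Let $k$ be an algebraically closed field of characteristic zero, let $1 \le r \le n$ and $m \ge 0$ be integers, and let $X=\operatorname{Spec} k[x_1,\ldots,x_n]/(x_1\cdots x_r)$. Let $R = k[x_i^{(j)} : 1\le i\le n,\ 0\le j\le m]$ and let $J_m(X)\subseteq R$ be the ideal generated by $g_0,\ldots,g_m$. Let $t_1,\ldots,t_r$ be integers with $0\le t_i\le m+1$ and $\sum_{i=1}^r t_i = m+1$, and let $P=P(m;t_1,\ldots,t_r)$. Then the multiplicity of $\mathcal{J}_m(X)$ along $P$, i.e. the length $\ell\big(R_P/J_m(X)R_P\big)$, equals $$\frac{(m+1)!}{t_1!\cdots t_r!}.$$
   Context: For $0\le k\le m$, $g_k$ denotes the coefficient of $t^k$ in the product $\prod_{i=1}^r (x_i^{(0)}+x_i^{(1)}t+\cdots+x_i^{(m)}t^m)$, i.e. $g_k=\sum x_1^{(i_1)}x_2^{(i_2)}\cdots x_r^{(i_r)}$, the sum over all tuples $(i_1,\ldots,i_r)$ of nonnegative integers with $\sum_j i_j = k$. The ideal $J_m(X)=(g_0,\ldots,g_m)$ defines the $m$-th jet scheme $\mathcal{J}_m(X)$ of $X$ inside $\mathcal{J}_m(\mathbb{A}^n)=\operatorname{Spec} R$. For nonnegative integers $t_1,\ldots,t_r$, $P(m;t_1,\ldots,t_r)$ is the prime ideal $(x_1^{(0)},\ldots,x_1^{(t_1-1)},\ldots,x_r^{(0)},\ldots,x_r^{(t_r-1)})$, where $t_i=0$ means no variable $x_i^{(j)}$ appears. (Such ideals with $\sum t_i=m+1$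 are exactly the minimal primes of $J_m(X)$.) $\ell$ denotes length of a module over the local ring $R_P$. *)

(* Defs.v *)
From HB Require Import structures.
From mathcomp Require Import all_boot all_order all_algebra.
From mathcomp Require Import mpoly.
Set Implicit Arguments. Unset Strict Implicit. Unset Printing Implicit Defensive.
Import Order.TTheory GRing.Theory.
Local Open Scope ring_scope.

Section Loc.
Variable A : comNzRingType.
Variable S : A -> Prop.   (* the multiplicative set, here the complement of P *)

(* a fraction a/s is encoded by the pair (a, s) with s in S *)
Definition frac_eq (a s b t : A) : Prop :=
  exists u, S u /\ u * (a * t - b * s) = 0.

(* an ideal of S^{-1}A, given as the set of its fractions *)
Definition loc_ideal (I : A -> A -> Prop) : Prop :=
  [/\ (forall a s, I a s -> S s),
      (forall a s b t, I a s -> S t -> frac_eq a s b t -> I b t),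
      I 0 1,
      (forall a s b t, I a s -> I b t -> I (a * t + b * s) (s * t))
    & (forall c u a s, S u -> I a s -> I (c * a) (u * s))].

Definition ext_ideal (J : A -> Prop) : A -> A -> Prop :=
  fun a s => S s /\ exists b t, [/\ J b, S t & frac_eq a s b t].

Definition same_ideal (I K : A -> A -> Prop) : Prop := forall a s, I a s <-> K a s.

Definition strict_sub (I K : A -> A -> Prop) : Prop :=
  (forall a s, I a s -> K a s) /\ exists a s, K a s /\ ~ I a s.

(* [loc_length J l]: the S^{-1}A-module S^{-1}A / J S^{-1}A has length l, i.e.
   it has a composition series of length l.  Submodules of S^{-1}A / J S^{-1}A
   are identified (correspondence theorem) with ideals of S^{-1}A containing
   J S^{-1}A; the series is J S^{-1}A = C_0 < C_1 < ... < C_l = S^{-1}A with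
   no ideal strictly between consecutive terms. *)
Definition loc_length (J : A -> Prop) (l : nat) : Prop :=
  exists C : nat -> A -> A -> Prop,
  [/\ (forall i, (i <= l)%N -> loc_ideal (C i)),
      same_ideal (C 0%N) (ext_ideal J),
      C l 1 1
    & (forall i, (i < l)%N ->
        strict_sub (C i) (C i.+1) /\
        ~ (exists K, [/\ loc_ideal K, strict_sub (C i) K & strict_sub K (C i.+1)]))].
End Loc.

Definition in_ideal_gen (A : comNzRingType) (I : finType) (g : I -> A) (f : A) : Prop :=
  exists c : I -> A, f = \sum_(i : I) c i * g i.

Section Jets.
Variable k : comNzRingType.
Variables (n m r : nat).

(* R = k[x_i^(j) : i < n, j <= m]; x_i^(j) is variable number mxvec_index i j.
   Indices i are 0-based: x_{i+1}^{(j)} of the paper is xv i j. *)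
Definition Rjet := {mpoly k[n * m.+1]}.
Definition xv (i : 'I_n) (j : 'I_m.+1) : Rjet := 'X_(mxvec_index i j).

(* g_kk = sum over (i_1,...,i_r) with sum kk of x_1^(i_1) ... x_r^(i_r);
   tuples are encoded as e : 'I_n -> 'I_m.+1 with e i = 0 for i >= r. *)
Definition gjet (kk : nat) : Rjet :=
  \sum_(e : {ffun 'I_n -> 'I_m.+1} |
          ((\sum_(i < n | (i < r)%N) (e i : nat))%N == kk)
          && [forall i : 'I_n, (r <= i)%N ==> (e i == ord0)])
     \prod_(i < n | (i < r)%N) xv i (e i).

Definition Jjet (f : Rjet) : Prop := in_ideal_gen (fun kk : 'I_m.+1 => gjet kk) f.

(* P(m; t_1,...,t_r) = (x_i^(j) : i < r, j < t_i)  (t is 0-indexed here) *)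
Definition Pjet (t : nat -> nat) (f : Rjet) : Prop :=
  in_ideal_gen (fun ij : {ij : 'I_n * 'I_m.+1 | ((ij.1 < r) && (ij.2 < t ij.1))%N} =>
                  xv (val ij).1 (val ij).2) f.
End Jets.

(* Main.v *)
(** Call P-chain a sequence of elements h_1, h_2, ... such that P kills each h_i modulo
    the ideal generated by J and the earlier h's; a P-chain reaching the unit ideal
    bounds the length of R_P/J R_P from above, and a shortest one computes it.

    Upper bound.  Modulo x_i^(j), j < a_i, the coefficient of index a_1 + ... + a_r of
    prod_i x_i(X) is prod_i x_i^(a_i), so this product lies in the ideal as long as
    the sum of the a_i is at most m.  Filtering by its partial products and adjoining
    one x_i^(a_i) at a time (those with a_i = t_i are units at P) produces a P-chain
    whose length N obeys the recursion of the multinomial coefficient.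

    Lower bound.  Let S be the splitting algebra of X^(m+1) over K = Frac R: it is free
    of rank (m+1)! over K, and X^(m+1) is the product of the X - y over m+1 elements y.
    Distributing these roots into blocks of sizes t_i, with products w_i, the map
    x_i(X) |-> w_i u_i, where u_i is a generic unit, kills J and inverts the complement
    of P.  Modulo P S each w_i becomes X^(t_i), and the upper-bound argument applied to
    the X - y gives a chain of length prod_i t_i! from P S to S.  A P-chain of length N
    thus yields a chain from 0 to S with N * prod_i t_i! steps, each of dimension at
    most one over K, whence (m+1)! <= N * prod_i t_i!. *)
Require Import Defs.
From HB Require Import structures.
From mathcomp Require Import all_boot all_order all_algebra.
From mathcomp Require Import mpoly ring zify.
Set Implicit Arguments. Unset Strict Implicit. Unset Printing Implicit Defensive.
Import GRing.Theory Pdiv.CommonRing Pdiv.RingMonic.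
Local Open Scope ring_scope.

(** * Chains of saturated ideals and the multinomial recursion *)

Section Chains.
Variables (A : comNzRingType) (M P : A -> Prop).
Implicit Types (I J K : A -> Prop) (x y c s h p : A) (hs : seq A).

(* Ideals of M^-1 A are encoded by their contractions to A. *)
Definition sat_ideal I :=
  [/\ I 0, forall x y, I x -> I y -> I (x + y), forall c x, I x -> I (c * x)
    & forall s x, M s -> I (s * x) -> I x].

Definition adjoin I h x := exists s c, M s /\ I (s * x - c * h).

Definition span I hs := foldl adjoin I hs.

(** Each quotient of consecutive ideals is cyclic and killed by [P]; it may be zero, so a chain
    bounds a length only from above. *)
Fixpoint chain I hs : Prop :=
  if hs is h :: hs' then (forall p, P p -> I (p * h)) /\ chain (adjoin I h) hs'
  else True.

Definition reach I n := exists hs, [/\ size hs = n, chain I hs & span I hs 1].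

Lemma sat_ideal0 I : sat_ideal I -> I 0. Proof. by case. Qed.

Lemma sat_idealD I x y : sat_ideal I -> I x -> I y -> I (x + y).
Proof. by case=> _ + _ _; apply. Qed.

Lemma sat_idealMl I c x : sat_ideal I -> I x -> I (c * x).
Proof. by case=> _ _ + _; apply. Qed.

Lemma sat_idealMr I c x : sat_ideal I -> I x -> I (x * c).
Proof. by rewrite mulrC; apply: sat_idealMl. Qed.

Lemma sat_idealN I x : sat_ideal I -> I x -> I (- x).
Proof. by rewrite -mulN1r; apply: sat_idealMl. Qed.

Lemma sat_idealB I x y : sat_ideal I -> I x -> I y -> I (x - y).
Proof. by move=> hI hx hy; apply: sat_idealD hx _ => //; apply: sat_idealN. Qed.

Lemma ideal_sat I s x : sat_ideal I -> M s -> I (s * x) -> I x.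
Proof. by case=> _ _ _; apply. Qed.

Lemma ideal_subr I x y : sat_ideal I -> I (x - y) -> I x -> I y.
Proof. by move=> hI hxy hx; rewrite -[y](subKr x); apply: sat_idealB. Qed.

Lemma ideal_subl I x y : sat_ideal I -> I (x - y) -> I y -> I x.
Proof. by move=> hI hxy hy; rewrite -[x](subrK y); apply: sat_idealD. Qed.

Lemma ideal_sum I (T : Type) (r : seq T) (Q : pred T) (F : T -> A) :
  sat_ideal I -> (forall i, Q i -> I (F i)) -> I (\sum_(i <- r | Q i) F i).
Proof.
move=> hI hF; apply: (big_ind I) => //; first exact: sat_ideal0.
by move=> x y; apply: sat_idealD.
Qed.

Hypothesis M1 : M 1.
Hypothesis MM : forall s1 s2, M s1 -> M s2 -> M (s1 * s2).

Lemma adjoin_sub I h x : I x -> adjoin I h x.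
Proof. by move=> hx; exists 1, 0; rewrite mul1r mul0r subr0. Qed.

Lemma adjoin_gen I h : sat_ideal I -> adjoin I h h.
Proof. by move=> hI; exists 1, 1; rewrite subrr; split => //; apply: sat_ideal0. Qed.

Lemma adjoin_ideal I h : sat_ideal I -> sat_ideal (adjoin I h).
Proof.
move=> hI; split.
- by apply: adjoin_sub; apply: sat_ideal0 hI.
- move=> x y [s [c [hs hx]]] [s' [c' [hs' hy]]].
  exists (s * s'), (s' * c + s * c'); split; first exact: MM.
  have -> : s * s' * (x + y) - (s' * c + s * c') * h
     = s' * (s * x - c * h) + s * (s' * y - c' * h).
    by ring.
  by apply: sat_idealD => //; apply: sat_idealMl.
- move=> c' x [s [c [hs hx]]]; exists s, (c' * c); split => //.
  by rewrite mulrCA -mulrA -mulrBr; apply: sat_idealMl.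
- move=> s' x hs' [s [c [hs hx]]]; exists (s * s'), c; split; first exact: MM.
  by rewrite -mulrA.
Qed.

Lemma adjoin_min I h K : sat_ideal K -> (forall x, I x -> K x) -> K h ->
  forall x, adjoin I h x -> K x.
Proof.
move=> hK hIK hh x [s [c [hs hx]]]; apply: (ideal_sat hK hs).
by apply: (ideal_subl hK (hIK _ hx)); apply: sat_idealMl.
Qed.

Lemma adjoin_unit I h : sat_ideal I -> M h -> adjoin I h 1.
Proof.
by move=> hI hh; exists h, 1; split; rewrite // mulrC subrr; apply: sat_ideal0.
Qed.

Lemma adjoin_mono I J h : (forall x, I x -> J x) ->
  forall x, adjoin I h x -> adjoin J h x.
Proof. by move=> hIJ x [s [c [hs hx]]]; exists s, c; split; auto. Qed.

Lemma span_ideal I hs : sat_ideal I -> sat_ideal (span I hs).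
Proof. by elim: hs I => //= h hs IH I hI; apply/IH/adjoin_ideal. Qed.

Lemma span_sub I hs x : I x -> span I hs x.
Proof. by elim: hs I => //= h hs IH I hI; apply/IH/adjoin_sub. Qed.

Lemma span_mono I J hs : (forall x, I x -> J x) ->
  forall x, span I hs x -> span J hs x.
Proof.
by elim: hs I J => [|h hs IH] I J hIJ //=; apply/IH/adjoin_mono.
Qed.

Lemma span_cat I hs hs' : span I (hs ++ hs') = span (span I hs) hs'.
Proof. exact: foldl_cat. Qed.

Lemma span_mul I J p hs : (forall x, I x -> J (p * x)) ->
  forall x, span I hs x -> span J (map ( *%R p) hs) (p * x).
Proof.
elim: hs I J => [|h hs IH] I J hIJ x //=; first exact: hIJ.
apply: IH => {}x [s [c [hs' hx]]]; exists s, c; split => //.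
by rewrite !(mulrCA _ p) -mulrBr; apply: hIJ.
Qed.

Lemma chain_mono I J hs : (forall x, I x -> J x) -> chain I hs -> chain J hs.
Proof.
elim: hs I J => [|h hs IH] I J hIJ //= [hP hc]; split; first by auto.
by apply: IH hc; apply: adjoin_mono.
Qed.

Lemma chain_cat I hs hs' :
  chain I (hs ++ hs') <-> chain I hs /\ chain (span I hs) hs'.
Proof.
by elim: hs I => [|h hs IH] I /=; [split=> [|[]] | rewrite IH; tauto].
Qed.

Lemma chain_mul I J p hs : (forall x, I x -> J (p * x)) ->
  chain I hs -> chain J (map ( *%R p) hs).
Proof.
elim: hs I J => [|h hs IH] I J hIJ //= [hP hc]; split.
  by move=> q hq; rewrite mulrCA; apply/hIJ/hP.
apply: IH hc => x [s [c [hs' hx]]]; exists s, c; split => //.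
by rewrite !(mulrCA _ p) -mulrBr; apply: hIJ.
Qed.

(* Filtration by the partial products of the f i: multiplication by a partial
   product pi embeds the chain above I + (f i) between pi * f i and pi. *)
Lemma reach_prod (T : Type) (r : seq T) (f : T -> A) (n : T -> nat) I :
  sat_ideal I -> I (\prod_(i <- r) f i) ->
  (forall i, reach (adjoin I (f i)) (n i)) -> reach I (\sum_(i <- r) n i)%N.
Proof.
move=> hI hprod hr.
suff: forall p, I (p * \prod_(i <- r) f i) -> exists hs,
    [/\ size hs = (\sum_(i <- r) n i)%N, chain I hs & span I hs p].
  by apply; rewrite mul1r.
elim: r {hprod} => [|i r IH] p hp.
  by exists [::]; rewrite big_nil; split => //=; rewrite big_nil mulr1 in hp.
rewrite big_cons mulrA in hp; have [hs [szs cs fs]] := IH _ hp.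
have [hs' [szs' cs' fs']] := hr i.
have key x : adjoin I (f i) x -> span I hs (p * x).
  have hS := span_ideal hs hI.
  case=> s [c [Ms hx]]; apply: (ideal_sat hS Ms); rewrite mulrCA.
  have: span I hs (p * (s * x - c * f i)).
    by apply: sat_idealMl => //; apply: span_sub.
  rewrite mulrBr => /(ideal_subl hS); apply.
  by rewrite mulrCA; apply: sat_idealMl.
exists (hs ++ map ( *%R p) hs'); split.
- by rewrite size_cat size_map szs szs' big_cons addnC.
- by apply/chain_cat; split => //; apply: chain_mul cs'.
- by have := span_mul key fs'; rewrite mulr1 span_cat.
Qed.

(** Modulo [I], [F] is divisible by [X^a] and [G] by [X^b], so the lowest surviving term of the
    product is the product of the two lowest terms. *)
Lemma ideal_coefM I (F G : {poly A}) a b : sat_ideal I ->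
    (forall j, (j < a)%N -> I F`_j) -> (forall j, (j < b)%N -> I G`_j) ->
  (forall j, (j < a + b)%N -> I (F * G)`_j) /\
  I ((F * G)`_(a + b) - F`_a * G`_b).
Proof.
move=> hI hF hG; split=> [j hj|].
  rewrite coefM; apply: ideal_sum => // l _.
  have [hl|hl] := ltnP l a; first by apply: sat_idealMr => //; apply: hF.
  by apply: sat_idealMl => //; apply: hG; have := ltn_ord l; lia.
rewrite coefM (bigD1 (inord a)) //= inordK ?ltnS ?leq_addr // addKn addrAC subrr add0r.
apply: ideal_sum => // l hl.
have {}hl : l != a :> nat by apply: contraNneq hl => hla; rewrite -val_eqE /= inordK ?ltnS ?leq_addr // hla.
have [hla|hla] := ltnP l a; first by apply: sat_idealMr => //; apply: hF.
apply: sat_idealMl => //; apply: hG; have := ltn_ord l; lia.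
Qed.

Lemma ideal_coef_prod I (T : Type) (r : seq T) (F : T -> {poly A}) (a : T -> nat) :
    sat_ideal I -> (forall i j, (j < a i)%N -> I (F i)`_j) ->
  (forall j, (j < \sum_(i <- r) a i)%N -> I (\prod_(i <- r) F i)`_j) /\
  I ((\prod_(i <- r) F i)`_(\sum_(i <- r) a i) - \prod_(i <- r) (F i)`_(a i)).
Proof.
move=> hI hF; elim: r => [|i r [IH1 IH2]].
  by rewrite !big_nil coef1 eqxx subrr; split => //; apply: sat_ideal0.
rewrite !big_cons; have [h1 h2] := ideal_coefM hI (hF i) IH1.
split=> //; rewrite -[_ - _](subrKA ((F i)`_(a i) * (\prod_(j <- r) F j)`_(\sum_(j <- r) a j))).
by apply: sat_idealD => //; rewrite -mulrBr; apply: sat_idealMl.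
Qed.

(** Induction on the number of coefficients still to be adjoined: the product of the next ones lies
    in the ideal, so [reach_prod] branches over [i], as in the recursion of multinomial
    coefficients. Here [q] counts the steps left once all coefficients of index below [t i] are in
    the ideal. *)
Lemma reach_coef_prod (T : finType) (F : T -> {poly A}) (t : T -> nat) q :
  (forall i, M (F i)`_(t i)) ->
  forall I, sat_ideal I ->
  (forall j, (j < \sum_i t i)%N -> I (\prod_i F i)`_j) ->
  (forall K, sat_ideal K -> (forall x, I x -> K x) ->
    (forall i j, (j < t i)%N -> K (F i)`_j) -> reach K q) ->
  exists n, reach I (n * q) /\ (n * \prod_i (t i)`!)%N = (\sum_i t i)`!.
Proof.
move=> hM I0 hI0 hprod0 hq.
(* a i counts the coefficients of F i already in the ideal *)
have gen: forall D (a : T -> nat) I, sat_ideal I -> (forall x, I0 x -> I x) ->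
    (forall i, a i <= t i)%N -> (\sum_i (t i - a i) = D)%N ->
    (forall i j, (j < a i)%N -> I (F i)`_j) ->
    exists n, reach I (n * q) /\ (n * \prod_i (t i - a i)`!)%N = D`!; last first.
  have [//|//|||n [h1 h2]] := gen (\sum_i t i)%N (fun=> 0%N) I0 hI0.
  - by apply: eq_bigr => i _; rewrite subn0.
  - by [].
  - by exists n; split => //; rewrite -h2; congr (_ * _)%N; apply: eq_bigr => i _; rewrite subn0.
elim=> [|D IH] a I hI hI0I hat hD ha.
  have a_t i : a i = t i.
    apply/eqP; rewrite eqn_leq hat /=.
    by move/eqP: hD; rewrite sum_nat_eq0 => /forallP/(_ i)/implyP/(_ isT).
  exists 1%N; rewrite !mul1n; split; last by rewrite big1 // => i _; rewrite a_t subnn.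
  by apply: hq => // i j; rewrite -a_t; apply: ha.
(* Branch [i] gets the share [t i - a i] of the total [D + 1]; in a finished block the next
   coefficient is a unit and no step is left. *)
have /fin_all_exists[n hn] i : exists ni,
    reach (adjoin I (F i)`_(a i)) (ni * q) /\
    (ni * \prod_l (t l - a l)`! = (t i - a i) * D`!)%N.
  have [ati|ati] := eqVneq (a i) (t i).
    exists 0%N; rewrite ati subnn; split => //.
    by exists [::]; split => //=; apply: adjoin_unit.
  have lti : (a i < t i)%N by rewrite ltn_neqAle ati hat.
  pose a' l := (a l + (l == i))%N.
  have sum_a' : (\sum_l (t l - a' l) = D)%N.
    apply: succn_inj; rewrite -hD (bigD1 i) //= [RHS](bigD1 i) //= /a' eqxx addn1.
    rewrite -(subnSK lti) addSn; congr (_ + _).+1.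
    by apply: eq_bigr => l /negPf->; rewrite addn0.
  have hI' := adjoin_ideal (F i)`_(a i) hI.
  have [|||ni [h1 h2]] := IH a' (adjoin I (F i)`_(a i)) hI' _ _ sum_a'.
  - by move=> x hx; apply/adjoin_sub/hI0I.
  - by move=> l; rewrite /a'; case: eqP => [->|_]; rewrite ?addn0 ?addn1.
  - move=> l j; rewrite /a'; case: eqP => [->|_].
      rewrite addn1 ltnS leq_eqVlt => /orP[/eqP->|hj]; first exact: adjoin_gen.
      exact/adjoin_sub/ha.
    by rewrite addn0 => hj; apply/adjoin_sub/ha.
  exists ni; split => //; rewrite -h2 (bigD1 i) //= [in RHS](bigD1 i) //= /a' eqxx addn1.
  rewrite -(subnSK lti) factS -mulnA [RHS]mulnCA; congr (ni * (_ * (_ * _)))%N.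
  by apply: eq_bigr => l /negPf->; rewrite addn0.
exists (\sum_i n i)%N; split.
  rewrite big_distrl /=; apply: (reach_prod (f := fun i => (F i)`_(a i))) => //.
    have [_ h] := ideal_coef_prod (index_enum T) hI ha.
    apply: (ideal_subr hI h); apply/hI0I/hprod0.
    rewrite -subn_gt0 -sumnB; last by move=> i _; apply: hat.
    by rewrite hD.
  by move=> i; case: (hn i).
rewrite big_distrl /= factS -hD big_distrl /=.
by apply: eq_bigr => i _; case: (hn i).
Qed.

End Chains.

(** With [M] equal to [eq 1] the saturation condition is void, so [sat_ideal (eq 1)] means a plain
    ideal, here the zero ideal. *)
Lemma sat_ideal_zero (S : comNzRingType) : sat_ideal (eq (1 : S)) (eq 0).
Proof.
by split=> // [x y <- <-|c x <-|s x <-]; rewrite ?addr0 ?mulr0 ?mul1r.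
Qed.

Lemma eq1_mul (S : comNzRingType) (a b : S) : 1 = a -> 1 = b -> 1 = a * b.
Proof. by move=> <- <-; rewrite mulr1. Qed.

(** * The splitting algebra of a monic polynomial *)

Section Splitting.

(** A root is adjoined in [A[X]/(f)], where [f] splits off a linear factor, and the construction
    repeats with the cofactor; [b] consists of products of powers of the successive roots. The last
    clause says that [S] is the image of [A] plus the ideal of the roots. *)
Lemma splitting_ring d (A : comNzRingType) (f : {poly A}) :
    f \is monic -> size f = d.+1 ->
  exists (S : comNzRingType) (iota : {rmorphism A -> S}) (y : 'I_d -> S)
    (B : finType) (b : B -> S),
  [/\ map_poly iota f = \prod_i ('X - (y i)%:P), #|B| = d`!,
      forall c : B -> A, \sum_i iota (c i) * b i = 0 -> forall i, c i = 0
    & forall s, exists c (z : 'I_d -> S), s = iota c + \sum_i z i * y i].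
Proof.
elim: d A f => [|d IH] A f fM szf.
  have f1 : f = 1.
    move: fM; rewrite [f]size1_polyC ?szf // monicE lead_coefC => /eqP->.
    by rewrite polyC1.
  exists A, idfun, (fun=> 0), unit, (fun=> 1); split.
  - by rewrite f1 rmorph1 big_ord0.
  - by rewrite card_unit.
  - move=> c; rewrite (bigD1 tt) //= big1 ?addr0 ?mulr1; last by case.
    by move=> c0 [].
  - by move=> s; exists s, (fun=> 0); rewrite big_ord0 addr0.
have mkf : mk_monic f = f by rewrite /mk_monic szf fM.
pose A1 : comNzRingType := {poly %/ f}.
pose j : {rmorphism A -> A1} := qpolyC f.
pose pi : {rmorphism {poly A} -> A1} := in_qpoly f.
have piC a : pi a%:P = j a.
  by apply: val_inj; rewrite /= rmodp_small // mkf szf ltnS (leq_trans (size_polyC_leq1 _)).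
have pi_horner p : pi p = (map_poly j p).[pi 'X].
  rewrite (@horner_coef_wide _ (size p)) ?size_poly //.
  rewrite -[in LHS](coefK p) poly_def rmorph_sum; apply: eq_bigr => i _.
  by rewrite -mul_polyC rmorphM rmorphXn piC coef_map.
have /factor_theorem[g fg] : root (map_poly j f) (pi 'X).
  rewrite /root -pi_horner; apply/eqP/val_inj.
  by rewrite /= mkf rmodpp.
have gM : g \is monic.
  by rewrite -(monicMr _ (monicXsubC (pi 'X))) -fg monic_map.
have szg : size g = d.+1.
  have : size (map_poly j f) = d.+2 by rewrite size_map_poly_id0 // (monicP fM) rmorph1 oner_eq0.
  by rewrite fg size_Mmonic ?monicXsubC ?monic_neq0 // size_XsubC addn2 => -[].
have [S [iota [y [B [b [fy cB bfree bgen]]]]]] := IH _ g gM szg.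
pose y' (i : 'I_d.+1) := if unlift ord0 i is Some i' then y i' else iota (pi 'X).
exists S, (iota \o j), y', ('I_d.+1 * B)%type, (fun ib : 'I_d.+1 * B => iota (pi 'X ^+ ib.1) * b ib.2).
have y'0 : y' ord0 = iota (pi 'X) by rewrite /y' unlift_none.
have y'S i : y' (lift ord0 i) = y i by rewrite /y' liftK.
split.
- rewrite map_poly_comp fg rmorphM /= fy big_ord_recl y'0 mulrC.
  rewrite rmorphB /= map_polyX map_polyC; congr (_ * _).
  by apply: eq_bigr => i _; rewrite y'S.
- by rewrite card_prod card_ord cB factS.
- move=> c.
  have -> : \sum_i (iota \o j) (c i) * (iota (pi 'X ^+ i.1) * b i.2)
      = \sum_(i < d.+1) \sum_l (iota \o j) (c (i, l)) * (iota (pi 'X ^+ i) * b l).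
    by rewrite pair_bigA; apply: eq_bigr => -[].
  rewrite exchange_big /= => hc [i0 l0].
  (* Freeness over [A[X]/(f)] kills each inner sum, which is the class of a polynomial of degree
     below that of [f]; this polynomial is therefore zero. *)
  have /bfree/(_ l0) : \sum_l iota (\sum_(i < d.+1) j (c (i, l)) * pi 'X ^+ i) * b l = 0.
    rewrite -[RHS]hc; apply: eq_bigr => l _; rewrite rmorph_sum mulr_suml.
    by apply: eq_bigr => i _; rewrite rmorphM mulrA.
  pose p := \poly_(i < d.+1) c (inord i, l0).
  have -> : \sum_(i < d.+1) j (c (i, l0)) * pi 'X ^+ i = pi p.
    rewrite [RHS]pi_horner (@horner_coef_wide _ d.+1); last first.
      exact: leq_trans (size_poly _ _) (size_poly _ _).
    apply: eq_bigr => i _; rewrite coef_map coef_poly ltn_ord.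
    by rewrite inord_val.
  move/(congr1 val); rewrite /= mkf rmodp_small ?szf ?ltnS ?size_poly //.
  by move/polyP/(_ i0); rewrite coef_poly ltn_ord inord_val coef0.
- move=> s; have [c [z ->]] := bgen s.
  pose p : {poly A} := val c.
  have cp : c = pi p.
    by apply: val_inj; rewrite /= rmodp_small // size_mk_monic.
  (* Writing [p] as its constant term plus [X] times a polynomial, the class of the latter is the
     coefficient of the new root. *)
  exists p`_0, (fun i => if unlift ord0 i is Some i' then z i' else iota (pi (\poly_(k < size p) p`_k.+1))).
  rewrite big_ord_recl unlift_none y'0 addrA; congr (_ + _); last first.
    by apply: eq_bigr => i _; rewrite liftK y'S.
  rewrite -rmorphM /= -rmorphD -(piC p`_0) -rmorphM -rmorphD; congr (iota _); rewrite cp; congr (pi _).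
  apply/polyP => -[|i]; rewrite coefD coefC coefMX /= ?addr0 // add0r coef_poly.
  by case: ltnP => // hi; rewrite nth_default // ltnW.
Qed.

End Splitting.

(** * Chain length as a bound on dimension *)

Section LinearCombination.
Variables (K : fieldType) (S : comNzRingType) (iota : {rmorphism K -> S}).
Variable P : S -> Prop.
Hypothesis hP : forall s, exists c z, P z /\ s = iota c + z.

(** Since [S] is the image of [K] plus [P], and [P] kills each chain element modulo the preceding
    ideal, coefficients can be taken in [K]. *)
Lemma chain_lincomb (I : S -> Prop) hs x :
    sat_ideal (eq 1) I -> chain (eq 1) P I hs -> span (eq 1) I hs x ->
  exists c : nat -> K, I (x - \sum_(i < size hs) iota (c i) * hs`_i).
Proof.
have M1 : (1 : S) = 1 by [].
have MM := @eq1_mul S.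
elim: hs I x => [|h hs IH] I x hI /=.
  by move=> _ hx; exists (fun=> 0); rewrite big_ord0 subr0.
case=> hh hc hx.
have [c [s [c0 [<-]]]] := IH _ x (adjoin_ideal M1 MM h hI) hc hx.
have [c1 [z [Pz ->]]] := hP c0; rewrite mul1r => hx'.
exists (fun i => if i is i'.+1 then c i' else c1).
rewrite big_ord_recl /=.
have -> : x - (iota c1 * h + \sum_(i < size hs) iota (c i) * hs`_i)
  = x - \sum_(i < size hs) iota (c i) * hs`_i - (iota c1 + z) * h + z * h by ring.
by apply: (sat_idealD hI) => //; apply: hh.
Qed.

(** The chain elements span [S] over [K]; with more than [n] elements in [B], the coordinate matrix
    would have a nonzero left kernel vector, that is, a linear relation. *)
Lemma free_leq_reach (B : finType) (b : B -> S) n :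
    (forall c : B -> K, \sum_i iota (c i) * b i = 0 -> forall i, c i = 0) ->
  reach (eq 1) P (eq 0) n -> (#|B| <= n)%N.
Proof.
move=> bfree [hs [szh hc h1]].
have hI := sat_ideal_zero S.
have M1 : (1 : S) = 1 by [].
have MM := @eq1_mul S.
have /fin_all_exists[c hcb] i : exists c : nat -> K,
    0 = b i - \sum_(l < size hs) iota (c l) * hs`_l.
  apply: chain_lincomb => //.
  by rewrite -[b i]mulr1; apply: sat_idealMl h1; apply: span_ideal.
rewrite leqNgt; apply/negP => lt_n.
pose C := \matrix_(i < #|B|, l < n) c (enum_val i) l.
have : kermx C != 0.
  by rewrite -mxrank_eq0 mxrank_ker subn_eq0 -ltnNge (leq_ltn_trans (rank_leq_col _)).
case/rowV0Pn=> v /sub_kermxP vC /negP[]; apply/eqP/rowP => i; rewrite mxE.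
rewrite -(enum_valK i); apply: (bfree (fun l => v 0 (enum_rank l))).
rewrite (eq_bigr (fun l => \sum_(q < n) iota (v 0 (enum_rank l) * c l q) * hs`_q)).
  rewrite exchange_big /= big1 // => q _.
  rewrite -mulr_suml -rmorph_sum (reindex (@enum_val B predT)) /=; last first.
    exact/onW_bij/enum_val_bij.
  suff -> : \sum_(l < #|B|) v 0 (enum_rank (enum_val l)) * c (enum_val l) q = (v *m C) 0 q.
    by rewrite vC mxE rmorph0 mul0r.
  by rewrite mxE; apply: eq_bigr => l _; rewrite mxE enum_valK.
move=> l _; move/esym/eqP: (hcb l); rewrite subr_eq0 => /eqP->; rewrite szh mulr_sumr.
by apply: eq_bigr => q _; rewrite rmorphM mulrA.
Qed.

End LinearCombination.

(** * Transport of chains along a ring morphism *)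

Section Transfer.
Variables (A S : comNzRingType) (psi : {rmorphism A -> S}).
Variables (M P : A -> Prop) (Q : S -> Prop) (T : nat).
Hypothesis psi_inv : forall s, M s -> exists v, v * psi s = 1.
Hypothesis reachT : forall K, sat_ideal (eq 1) K ->
  (forall p, P p -> K (psi p)) -> reach (eq 1) Q K T.

(** A step [h] becomes [psi h] times a chain of length [T] that starts at the colon ideal of [psi h]
    in [K]; this ideal contains the image of [P], as [P] kills [h] modulo [I]. *)
Lemma chain_transfer hs I K : sat_ideal (eq 1) K ->
    (forall x, I x -> K (psi x)) -> chain M P I hs ->
  exists hs', [/\ size hs' = (size hs * T)%N, chain (eq 1) Q K hs'
    & forall x, span M I hs x -> span (eq 1) K hs' (psi x)].
Proof.
have M1 : (1 : S) = 1 by [].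
have MM := @eq1_mul S.
elim: hs I K => [|h hs IH] I K hK hIK /=; first by exists [::].
case=> hh hc.
have [|p Pp|hs1 [sz1 c1 s1]] := reachT (K := fun x => K (psi h * x)).
- split=> [|x y hx hy|c x hx|s x <-]; rewrite ?mulr0 ?mul1r //.
  + exact: sat_ideal0 hK.
  + by rewrite mulrDr; apply: (sat_idealD hK).
  + by rewrite mulrCA; apply: (sat_idealMl _ hK).
- by rewrite mulrC -rmorphM; apply/hIK/hh.
have hK1 := span_ideal M1 MM (map ( *%R (psi h)) hs1) hK.
have [|hs2 [sz2 c2 s2]] := IH _ _ hK1 _ hc.
  move=> x [s [c [Ms hx]]]; have [v hv] := psi_inv Ms.
  have -> : psi x = v * psi (s * x) by rewrite rmorphM mulrA hv mul1r.
  apply: (sat_idealMl _ hK1).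
  apply: (ideal_subl hK1 (y := psi (c * h))).
    by rewrite -rmorphB; apply/(span_sub M1)/hIK.
  rewrite rmorphM; apply: (sat_idealMl _ hK1).
  by have := span_mul (J := K) (fun x (hx : K (psi h * x)) => hx) s1; rewrite mulr1.
exists (map ( *%R (psi h)) hs1 ++ hs2); split.
- by rewrite size_cat size_map sz1 sz2 mulSn.
- by apply/chain_cat; split => //; apply: chain_mul c1.
- by move=> x hx; rewrite span_cat; apply: s2.
Qed.

Lemma reach_transfer I n : (forall x, I x -> psi x = 0) ->
  reach M P I n -> reach (eq 1) Q (eq 0) (n * T).
Proof.
move=> hI [hs [<- hc h1]].
have [||hs' [sz' c' h']] := chain_transfer (K := eq 0) _ _ hc.
- exact: sat_ideal_zero.
- by move=> x /hI->.
- by exists hs'; split => //; have := h' _ h1; rewrite rmorph1.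
Qed.

End Transfer.

(** * From shortest chains to composition series *)

Section LocLength.
Variables (A : comNzRingType) (M P J : A -> Prop).
Hypothesis M1 : M 1.
Hypothesis MM : forall s1 s2, M s1 -> M s2 -> M (s1 * s2).
Hypothesis MVP : forall s, M s \/ P s.
Hypothesis J_ideal : sat_ideal (eq 1) J.

(** This is the contraction to [A] of the extension of [J] to [M^-1 A]. *)
Definition saturation x := exists s, M s /\ J (s * x).

Lemma saturation_ideal : sat_ideal M saturation.
Proof.
split.
- by exists 1; rewrite mulr0; split => //; apply: sat_ideal0 J_ideal.
- move=> x y [s [Ms hx]] [s' [Ms' hy]]; exists (s * s'); split; first exact: MM.
  have -> : s * s' * (x + y) = s' * (s * x) + s * (s' * y) by ring.
  by apply: (sat_idealD J_ideal); apply: (sat_idealMl _ J_ideal).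
- move=> c x [s [Ms hx]]; exists s; split => //.
  by rewrite mulrCA; apply: (sat_idealMl _ J_ideal).
- move=> s x Ms [s' [Ms' hx]]; exists (s' * s); split; first exact: MM.
  by rewrite -mulrA.
Qed.

Lemma saturation_sub x : J x -> saturation x.
Proof. by move=> hx; exists 1; rewrite mul1r. Qed.

Lemma loc_ideal_contraction I : sat_ideal M I -> loc_ideal M (fun a s => M s /\ I a).
Proof.
move=> hI; split.
- by move=> a s [].
- move=> a s b t [Ms Ia] Mt [u [Mu hu]]; split => //.
  apply: (ideal_sat hI (MM Mu Ms)); rewrite -mulrA.
  have -> : u * (s * b) = t * u * a - u * (a * t - b * s) by ring.
  by rewrite hu subr0; apply: (sat_idealMl _ hI).
- by split=> //; apply: sat_ideal0 hI.
- move=> a s b t [Ms Ia] [Mt Ib]; split; first exact: MM.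
  by apply: (sat_idealD hI); apply: (sat_idealMr _ hI).
- by move=> c u a s Mu [Ms Ia]; split; [apply: MM | apply: (sat_idealMl _ hI)].
Qed.

Lemma ext_ideal_saturation a s : M s /\ saturation a <-> ext_ideal M J a s.
Proof.
split=> [[Ms [u [Mu hu]]]|[Ms [b [t [Jb Mt [u [Mu hu]]]]]]]; split => //.
  exists (u * a), (u * s); split=> //; first exact: MM.
  by exists 1; split => //; ring.
exists (u * t); split; first exact: MM.
have -> : u * t * a = u * s * b + u * (a * t - b * s) by ring.
by rewrite hu addr0; apply: (sat_idealMl _ J_ideal).
Qed.

Lemma frac_ideal_numerator (K : A -> A -> Prop) a s t :
  loc_ideal M K -> K a s -> M t -> K a t.
Proof.
case=> KM Kfrac _ _ Kscale Kas Mt; have Ms := KM _ _ Kas.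
apply: (Kfrac (s * a) (t * s)) => //; first exact: Kscale.
by exists 1; split => //; ring.
Qed.

(** A numerator [a] from [K] outside [I] satisfies [u * a = c * h] modulo [I] with [u] in [M]. If
    [c] lay in [P], then [a] would be in [I]; so [c] is in [M], and [K] contains [h], hence all of
    [adjoin M I h]. *)
Lemma no_ideal_between I h : sat_ideal M I -> (forall p, P p -> I (p * h)) ->
  ~ exists K, [/\ loc_ideal M K, strict_sub (fun a s => M s /\ I a) K
    & strict_sub K (fun a s => M s /\ adjoin M I h a)].
Proof.
move=> hI hP [K [hK [IK [a [s [Kas nIas]]]] [KA [b [t [[Mt hb] nKbt]]]]]].
have num := frac_ideal_numerator hK.
have [KM Kfrac K0 Kadd Kscale] := hK.
have Kmul c x : K x 1 -> K (c * x) 1.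
  by move=> Kx; rewrite -[1 in X in K _ X]mulr1; apply: Kscale.
have Ks u x : M u -> K (u * x) 1 -> K x 1.
  move=> Mu Kux; apply: (Kfrac (1 * (u * x)) (u * 1)); [exact: Kscale | by [] |].
  by exists 1; split => //; ring.
have KB x y : K x 1 -> K y 1 -> K (x - y) 1.
  move=> Kx Ky; have := Kadd _ _ _ _ Kx (Kmul (-1) _ Ky).
  by rewrite !mulr1 mulN1r.
have Ms := KM _ _ Kas; have Ka := num _ _ _ Kas M1.
have IK1 x : I x -> K x 1 by move=> Ix; apply: IK.
have [_ [u [c [Mu hu]]]] := KA _ _ Kas.
case: (MVP c) => [Mc|Pc]; last first.
  apply: nIas; split => //; apply: (ideal_sat hI Mu).
  by apply: (ideal_subl hI hu); apply: hP.
have Kh : K h 1.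
  apply: (Ks c) => //; have -> : c * h = u * a - (u * a - c * h) by ring.
  by apply: KB; [apply: Kmul | apply: IK1].
apply: nKbt; apply: num Mt; have [u' [c' [Mu' hu']]] := hb.
apply: (Ks u') => //; have -> : u' * b = (u' * b - c' * h) - (- c') * h by ring.
by apply: KB; [apply: IK1 | apply: Kmul].
Qed.

(** Steps are simple by [no_ideal_between] and strict by minimality: a step with zero quotient could
    be deleted, giving a shorter chain. *)
Lemma loc_length_reach n : reach M P saturation n ->
  (forall n', reach M P saturation n' -> (n <= n')%N) -> loc_length M J n.
Proof.
move=> [hs [szhs hc h1]] nmin; have hI := saturation_ideal.
have split_at i : (i < n)%N -> [/\ hs = take i hs ++ hs`_i :: drop i.+1 hs,
    take i.+1 hs = rcons (take i hs) hs`_i,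
    chain M P saturation (take i hs),
    forall p, P p -> span M saturation (take i hs) (p * hs`_i)
    & chain M P (adjoin M (span M saturation (take i hs)) hs`_i) (drop i.+1 hs)].
  rewrite -szhs => hi; have e : hs = take i hs ++ hs`_i :: drop i.+1 hs.
    by rewrite -drop_nth // cat_take_drop.
  have := hc; rewrite {1}e => /chain_cat[c1 [c2 c3]].
  by split=> //; rewrite -take_nth.
exists (fun i a s => M s /\ span M saturation (take i hs) a); split.
- by move=> i _; apply/loc_ideal_contraction/span_ideal.
- by move=> a s; rewrite take0; apply: ext_ideal_saturation.
- by split => //; rewrite take_oversize ?szhs.
move=> i /split_at[e eS c1 c2 c3]; set I := span M saturation (take i hs) in c2 c3.
have hIi : sat_ideal M I by apply: span_ideal.
have -> : span M saturation (take i.+1 hs) = adjoin M I hs`_i.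
  by rewrite eS -cats1 span_cat.
split; last exact: no_ideal_between.
split=> [a s [Ms Ia]|]; first by split => //; apply: adjoin_sub.
exists hs`_i, 1; split=> [|[_ Ih]]; first by split => //; apply: adjoin_gen.
have adjI : forall x, adjoin M I hs`_i x -> I x by apply: adjoin_min Ih.
have : (n <= size (take i hs ++ drop i.+1 hs))%N.
  apply: nmin; exists (take i hs ++ drop i.+1 hs); split => //.
    by apply/chain_cat; split => //; apply: chain_mono c3.
  rewrite span_cat; apply: (span_mono adjI).
  by move: h1; rewrite [in span _ _ hs]e span_cat.
by rewrite -szhs [in size hs]e !size_cat /= addnS ltnn.
Qed.

End LocLength.

(** * Plain ideals, nilpotents and congruences between coefficients *)

Section PlainIdeals.

Lemma nilpotent_ideal (S : comNzRingType) :
  sat_ideal (eq 1) (fun x : S => exists n, x ^+ n = 0).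
Proof.
split=> [|x y [a xa] [b yb]|c x [n xn]|s x <- [n]].
- by exists 1%N.
- exists (a + b)%N; rewrite exprDn big1 // => i _.
  have [hi|hi] := leqP b i; first by rewrite -(subnK hi) [y ^+ _]exprD yb !mulr0 mul0rn.
  have ha : (a <= a + b - i)%N by lia.
  by rewrite -(subnK ha) exprD xa mulr0 mul0r mul0rn.
- by exists n; rewrite exprMn xn mulr0.
- by rewrite mul1r => hn; exists n.
Qed.

(** The inverse comes from the geometric series in [1 - v * x], which is nilpotent. *)
Lemma unit_add_nilpotent (S : comNzRingType) (u v x : S) n :
  v * u = 1 -> (x - u) ^+ n = 0 -> exists w, w * x = 1.
Proof.
move=> vu xn; have zn : (1 - v * x) ^+ n = 0.
  by rewrite -vu -mulrBr -opprB mulrN exprNn exprMn xn !mulr0.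
exists ((\sum_(i < n) (1 - v * x) ^+ i) * v).
have := subrX1 (1 - v * x) n; rewrite zn addrAC subrr !add0r mulNr => /oppr_inj e.
by rewrite [RHS]e -mulrA mulrC.
Qed.

Lemma in_ideal_gen_ideal (A : comNzRingType) (T : finType) (g : T -> A) :
  sat_ideal (eq 1) (in_ideal_gen g).
Proof.
split=> [|x y [c ->] [c' ->]|a x [c ->]|s x <-]; last by rewrite mul1r.
- by exists (fun=> 0); rewrite big1 // => i _; rewrite mul0r.
- exists (fun i => c i + c' i); rewrite -big_split.
  by apply: eq_bigr => i _; rewrite mulrDl.
- exists (fun i => a * c i); rewrite mulr_sumr.
  by apply: eq_bigr => i _; rewrite mulrA.
Qed.

Lemma in_ideal_gen_mem (A : comNzRingType) (T : finType) (g : T -> A) i :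
  in_ideal_gen g (g i).
Proof.
exists (fun l => (l == i)%:R); rewrite (bigD1 i) //= eqxx mul1r big1 ?addr0 //.
by move=> l /negPf->; rewrite mul0r.
Qed.

Lemma in_ideal_gen_min (A : comNzRingType) (T : finType) (g : T -> A) M K :
  sat_ideal M K -> (forall i, K (g i)) -> forall x, in_ideal_gen g x -> K x.
Proof.
move=> hK hg x [c ->]; apply: (ideal_sum _ hK) => i _.
exact: (sat_idealMl _ hK (hg i)).
Qed.

Lemma prod_congr_coef (A : comNzRingType) M (I : A -> Prop) (T : Type) (r : seq T)
    (F G : T -> {poly A}) N : sat_ideal M I ->
  (forall i j, (j < N)%N -> I ((F i)`_j - (G i)`_j)) ->
  forall j, (j < N)%N -> I ((\prod_(i <- r) F i)`_j - (\prod_(i <- r) G i)`_j).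
Proof.
move=> hI hFG; apply: (big_ind2 (fun p q : {poly A} =>
    forall j, (j < N)%N -> I (p`_j - q`_j))); last by move=> i _; apply: hFG.
  by move=> j _; rewrite subrr; apply: sat_ideal0 hI.
move=> p p' q q' hp hq j hj; rewrite !coefM -sumrB; apply: (ideal_sum _ hI) => l _.
have -> : p`_l * q`_(j - l) - p'`_l * q'`_(j - l)
   = (p`_l - p'`_l) * q`_(j - l) + p'`_l * (q`_(j - l) - q'`_(j - l)) by ring.
have := ltn_ord l; rewrite ltnS => hl.
apply: (sat_idealD hI); [apply: (sat_idealMr _ hI) | apply: (sat_idealMl _ hI)].
  by apply: hp; apply: leq_ltn_trans hj.
by apply: hq; apply: leq_ltn_trans hj; apply: leq_subr.
Qed.

(** [U] is invertible as a power series, so the coefficients of [F] are recovered in turn from those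
    of [F * U]. *)
Lemma ideal_coef_divr (A : comNzRingType) M (I : A -> Prop) (F U : {poly A}) v t :
    sat_ideal M I -> v * U`_0 = 1 ->
  (forall j, (j < t)%N -> I (F * U)`_j) -> forall j, (j < t)%N -> I F`_j.
Proof.
move=> hI vU hFU j; elim/ltn_ind: j => j IH hj.
have -> : F`_j = v * (F`_j * U`_0) by rewrite mulrCA vU mulr1.
apply: (sat_idealMl _ hI); have := hFU j hj.
rewrite coefM big_ord_recr /= subnn addrC => h.
rewrite -[X in I X](addrK (\sum_(i < j) F`_i * U`_(j - i))).
apply: (sat_idealB hI) => //; apply: (ideal_sum _ hI) => i _.
by apply: (sat_idealMr _ hI); apply: IH => //; apply: ltn_trans hj.
Qed.

Lemma mpoly_rmorph_congr (k : comNzRingType) N (S : comNzRingType)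
    (f g : {rmorphism {mpoly k[N]} -> S}) (I : S -> Prop) :
    sat_ideal (eq 1) I -> (forall c, I (f c%:MP - g c%:MP)) ->
  (forall i, I (f 'X_i - g 'X_i)) -> forall p, I (f p - g p).
Proof.
move=> hI hC hX.
have hM p q : I (f p - g p) -> I (f q - g q) -> I (f (p * q) - g (p * q)).
  move=> hp hq; rewrite !rmorphM.
  have -> : f p * f q - g p * g q = (f p - g p) * f q + g p * (f q - g q) by ring.
  by apply: (sat_idealD hI); [apply: (sat_idealMr _ hI) | apply: (sat_idealMl _ hI)].
have h1 : I (f 1 - g 1) by rewrite !rmorph1 subrr; apply: sat_ideal0 hI.
move=> p; elim/mpolyind: p => [|c m p _ _ IH]; first by rewrite !rmorph0 subrr; apply: sat_ideal0 hI.
rewrite !rmorphD opprD addrACA; apply: (sat_idealD hI) => //.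
rewrite -mul_mpolyC; apply: (hM) => //; rewrite mpolyXE_id.
apply: (big_ind (fun q => I (f q - g q)) h1 hM) => i _.
by elim: (m i) => [|n IHn]; rewrite ?expr0 // exprS; apply: (hM).
Qed.

End PlainIdeals.

(** * Adjoining the roots block by block *)

Section RootChain.
Variables (S : comNzRingType) (T : finType) (t : T -> nat).
Variable y : forall i : T, 'I_(t i) -> S.
Let w i := \prod_(l < t i) ('X - (y l)%:P).
Let Q z := exists c : forall i : T, 'I_(t i) -> S, z = \sum_i \sum_l c i l * y l.

(** For each block, [reach_coef_prod] applies to the linear factors [X - y l] with one coefficient
    each to adjoin, the root up to sign, and multiplies the count by [(t i)!]. *)
Lemma reach_roots K : sat_ideal (eq 1) K ->
    (forall i j, (j < t i)%N -> K (w i)`_j) ->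
  reach (eq 1) Q K (\prod_i (t i)`!).
Proof.
have M1 : (1 : S) = 1 by [].
have MM := @eq1_mul S.
move=> hK hw; rewrite -[X in reach _ _ _ X]muln1.
suff: forall (r : seq T) K q, sat_ideal (eq 1) K ->
    (forall i j, (j < t i)%N -> K (w i)`_j) ->
    (forall K', sat_ideal (eq 1) K' -> (forall x, K x -> K' x) ->
      (forall i, i \in r -> forall l : 'I_(t i), K' (y l)) -> reach (eq 1) Q K' q) ->
    reach (eq 1) Q K (\prod_(i <- r) (t i)`! * q).
  apply=> // K' hK' _ hy; exists [:: 1]; split=> //=; last exact: adjoin_gen.
  split=> // _ [c ->]; rewrite mulr1; apply: (ideal_sum _ hK') => i _.
  apply: (ideal_sum _ hK') => l _; apply: (sat_idealMl _ hK'); apply: hy.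
  exact: mem_index_enum.
elim=> [|i r IH] {hw}{}K q {}hK hw hq; first by rewrite big_nil mul1n; apply: hq.
pose F (l : 'I_(t i)) := 'X - (y l)%:P.
have st : (\sum_(l < t i) 1 = t i)%N by rewrite sum1_card card_ord.
have [|||n] := @reach_coef_prod S (eq 1) Q M1 MM _ F (fun=> 1%N)
  (\prod_(i <- r) (t i)`! * q) _ _ hK.
- by move=> l; rewrite coefB coefX coefC subr0.
- by rewrite st; apply: hw.
- move=> K' hK' KK' hF; apply: IH => // [i' j hj|K2 hK2 K'K2 hy]; first by apply/KK'/hw.
  apply: hq => // [x hx|i']; first by apply/K'K2/KK'.
  rewrite inE => /orP[/eqP->|/hy//] l; apply: K'K2.
  have := hF l 0%N isT; rewrite coefB coefX coefC sub0r => /(sat_idealN hK').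
  by rewrite opprK.
- by rewrite big_cons -mulnA => -[hn]; rewrite st big1 ?muln1 // => <-.
Qed.

End RootChain.

(** * Jet equations and the upper bound *)

Section Jets.
Variables (k : fieldType) (n m r : nat) (hrn : (r <= n)%N) (t : nat -> nat).
Local Notation R := {mpoly k[n * m.+1]}.
Local Notation x_ := (@xv k n m).
Local Notation w := (widen_ord hrn).

Definition jet_eval (S : comNzRingType) (f : {rmorphism k -> S})
    (h : 'I_n -> 'I_m.+1 -> S) : {rmorphism R -> S} :=
  mmap f (fun v => let ij := enum_val (cast_ord (esym (mxvec_cast n m.+1)) v) in
                   h ij.1 ij.2).

Lemma jet_evalX (S : comNzRingType) (f : {rmorphism k -> S}) h i j :
  jet_eval f h (x_ i j) = h i j.
Proof. by rewrite /= mmapX mmap1U /mxvec_index cast_ordK enum_rankK. Qed.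

Lemma jet_evalC (S : comNzRingType) (f : {rmorphism k -> S}) h c :
  jet_eval f h c%:MP = f c.
Proof. exact: mmapC. Qed.

Lemma jet_rmorph_congr (S : comNzRingType) (f g : {rmorphism R -> S}) I :
    sat_ideal (eq 1) I -> (forall c, I (f c%:MP - g c%:MP)) ->
  (forall i j, I (f (x_ i j) - g (x_ i j))) -> forall p, I (f p - g p).
Proof.
move=> hI hC hX; apply: mpoly_rmorph_congr => // v.
by case/mxvec_indexP: v => i j; apply: hX.
Qed.

(** In degree at most [m] each factor may be replaced by its truncation after [X^m]; distributing
    the product over the sums then gives [gjet]. *)
Lemma coef_prod_gjet (F : 'I_r -> {poly R}) :
    (forall i (j : 'I_m.+1), (F i)`_j = x_ (w i) j) ->
  forall d, (d < m.+1)%N -> (\prod_i F i)`_d = gjet k n m r d.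
Proof.
move=> hF d hd; pose G i : {poly R} := \sum_(j < m.+1) x_ i j *: 'X^j.
have hFG : forall i j, (j < m.+1)%N -> 0 = (F i)`_j - (G (w i))`_j.
  move=> i j hj; rewrite (hF i (Ordinal hj)) coef_sum (bigD1 (Ordinal hj)) //=.
  rewrite coefZ coefXn eqxx mulr1 big1 ?addr0 ?subrr // => l hl.
  rewrite coefZ coefXn; case: eqP => [e|_]; last by rewrite mulr0.
  by case/eqP: hl; apply: val_inj; rewrite /= e.
have /esym/eqP := prod_congr_coef (index_enum 'I_r) (sat_ideal_zero R) hFG hd.
rewrite subr_eq0 => /eqP->.
rewrite -(big_ord_narrow hrn (F := G)) /= (big_distr_big_dep ord0) /= coef_sum.
rewrite /gjet [RHS]big_mkcondl /= [RHS]big_mkcond /= [LHS]big_mkcond /=.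
apply: eq_bigr => e _.
have -> : (e \in pfamily ord0 (fun i : 'I_n => (i < r)%N) (fun _ => xpredT))
   = [forall i : 'I_n, (r <= i)%N ==> (e i == ord0)].
  apply/pfamilyP/forallP => [[/subsetP he _] i|he].
    apply/implyP; rewrite leqNgt; apply: contraR => ei.
    by apply: he; rewrite unfold_in.
  split=> //; apply/subsetP => i; rewrite unfold_in; apply: contraR; rewrite -leqNgt.
  exact/implyP/he.
case: ifP => // _.
have -> : \prod_(i < n | (i < r)%N) (x_ i (e i) *: 'X^(e i) : {poly R})
  = \prod_(i < n | (i < r)%N) x_ i (e i) *: 'X^(\sum_(i < n | (i < r)%N) (e i : nat)).
  by rewrite scaler_prod -expr_sum.
by rewrite coefZ coefXn eq_sym; case: eqP; rewrite ?mulr1 ?mulr0.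
Qed.

(** This retraction has kernel [Pjet], which makes membership decidable and, [R] being a domain,
    [Pjet] prime. *)
Definition kill_P : {rmorphism R -> R} :=
  jet_eval (@mpolyC _ k) (fun i j => if ((i < r) && (j < t i))%N then 0 else x_ i j).

Lemma Pjet_var (i : 'I_n) (j : 'I_m.+1) : (i < r)%N -> (j < t i)%N -> Pjet r t (x_ i j).
Proof.
move=> hi hj; have h : (((i, j).1 < r) && ((i, j).2 < t (i, j).1))%N by rewrite hi.
exact: (in_ideal_gen_mem (fun ij : {ij : 'I_n * 'I_m.+1 | ((ij.1 < r) && (ij.2 < t ij.1))%N} =>
                  x_ (val ij).1 (val ij).2) (Sub (i, j) h)).
Qed.

Lemma PjetP p : reflect (Pjet r t p) (kill_P p == 0).
Proof.
apply: (iffP eqP) => [p0|].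
  rewrite -[p]subr0 -p0.
  apply: (jet_rmorph_congr (f := idfun) (g := kill_P) (in_ideal_gen_ideal _)).
    move=> c; rewrite jet_evalC subrr.
    exact: sat_ideal0 (in_ideal_gen_ideal _).
  move=> i j; rewrite jet_evalX; case: ifP => [/andP[hi hj]|_].
    by rewrite subr0; apply: Pjet_var.
  by rewrite subrr; apply: sat_ideal0 (in_ideal_gen_ideal _).
move: p; apply: (@in_ideal_gen_min R _ _ (eq 1) (fun p => kill_P p = 0)).
  split=> [|x y hx hy|c x hx|s x <-]; rewrite ?rmorph0 ?mul1r //.
    by rewrite rmorphD hx hy addr0.
  by rewrite rmorphM hx mulr0.
by case=> -[i j] hij; rewrite jet_evalX; move: hij => /= ->.
Qed.

Lemma notPjet1 : ~ @Pjet k n m r t 1.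
Proof. by move/PjetP; rewrite rmorph1 oner_eq0. Qed.

Lemma notPjetM p q : ~ @Pjet k n m r t p -> ~ @Pjet k n m r t q ->
  ~ @Pjet k n m r t (p * q).
Proof.
by move=> /PjetP hp /PjetP hq /PjetP; rewrite rmorphM mulf_eq0 (negPf hp) (negPf hq).
Qed.

Hypothesis ht : forall i, (i < r)%N -> (t i <= m.+1)%N.
Hypothesis hsum : (\sum_(i < r) t i)%N = m.+1.

(* The term X^(m+1) does not affect the coefficients up to X^m; it makes the
   coefficient of index t i a unit at P also when t i = m+1. *)
Definition jet_poly (i : 'I_r) : {poly R} :=
  \poly_(j < m.+1) x_ (w i) (inord j) + (if t i == m.+1 then 'X^(m.+1) else 0).

Lemma coef_jet_poly i (j : 'I_m.+1) : (jet_poly i)`_j = x_ (w i) j.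
Proof.
rewrite coefD coef_poly ltn_ord inord_val; case: ifP => _; last by rewrite coef0 addr0.
by rewrite coefXn ltn_eqF ?addr0.
Qed.

Lemma jet_poly_lead i : ~ Pjet r t (jet_poly i)`_(t i).
Proof.
rewrite coefD coef_poly; have hti := ht (ltn_ord i).
case: (eqVneq (t i) m.+1) => [->|nti].
  by rewrite ltnn add0r coefXn eqxx; apply: notPjet1.
have lti : (t i < m.+1)%N by rewrite ltn_neqAle nti.
rewrite lti coef0 addr0 => /PjetP; rewrite jet_evalX /= inordK // ltnn andbF.
by rewrite -msupp_eq0 msuppX.
Qed.

Lemma reach_jet : exists N,
  reach (fun s => ~ Pjet r t s) (@Pjet k n m r t)
    (saturation (fun s => ~ Pjet r t s) (@Jjet k n m r)) N
  /\ (N * \prod_(i < r) (t i)`!)%N = (m.+1)`!.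
Proof.
have hI : sat_ideal (fun s => ~ Pjet r t s)
    (saturation (fun s => ~ Pjet r t s) (@Jjet k n m r)).
  exact: saturation_ideal notPjet1 notPjetM (in_ideal_gen_ideal _).
have [|||N [h1 h2]] := reach_coef_prod notPjet1 notPjetM (F := jet_poly) (t := fun i => t i)
  (q := 1) (P := @Pjet k n m r t) _ hI.
- exact: jet_poly_lead.
- rewrite hsum => j hj; rewrite (coef_prod_gjet coef_jet_poly) //.
  apply: (saturation_sub notPjet1).
  exact: (in_ideal_gen_mem (fun kk : 'I_m.+1 => gjet k n m r kk) (Ordinal hj)).
(* By now [K] contains all of [Pjet], so the single step [1] completes the chain. *)
- move=> K hK _ hKF; exists [:: 1]; split=> //=; last exact: (adjoin_gen notPjet1).
  split=> // p Pp; rewrite mulr1; move: p Pp; apply: (in_ideal_gen_min hK).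
  case=> -[i j] /= /andP[hi hj].
  have := hKF (Ordinal hi) j hj; rewrite coef_jet_poly.
  by rewrite (_ : w (Ordinal hi) = i) //; apply: val_inj.
- by exists N; rewrite muln1 in h1; rewrite h2 hsum.
Qed.

End Jets.

(** * The lower bound: mapping jets to the splitting algebra *)

Section LowerBound.
Variables (k : fieldType) (n m r : nat) (hrn : (r <= n)%N) (t : nat -> nat).
Local Notation R := {mpoly k[n * m.+1]}.
Local Notation x_ := (@xv k n m).
Local Notation w := (widen_ord hrn).
Hypothesis ht : forall i, (i < r)%N -> (t i <= m.+1)%N.

Variables (S : comNzRingType) (iota : {rmorphism {fraction R} -> S}).
Variable y : forall i : 'I_r, 'I_(t i) -> S.
Let root_poly (i : 'I_r) := \prod_(l < t i) ('X - (y l)%:P).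
Let Q z := exists c : forall i : 'I_r, 'I_(t i) -> S, z = \sum_i \sum_l c i l * y l.
Hypothesis prod_root_poly : \prod_i root_poly i = 'X^(m.+1).

Let iotaR (p : R) : S := iota (tofrac p).

(* The map psi to be defined sends x_i(X) to root_poly i * unit_poly i. *)
Definition unit_poly (i : 'I_r) : {poly S} :=
  \poly_(j < m.+1 - t i) iotaR (x_ (w i) (inord (t i + j)))
  + (if t i == m.+1 then 1 else 0).

Lemma size_root_poly i : size (root_poly i) = (t i).+1.
Proof.
by rewrite size_prod_XsubC /index_enum -enumT size_enum_ord.
Qed.

Lemma monic_root_poly i : root_poly i \is monic.
Proof. exact: monic_prod_XsubC. Qed.

(** The constant term is a variable, invertible in the fraction field, or [1] when [t i = m + 1]. *)
Lemma unit_poly0_inv i : exists v, v * (unit_poly i)`_0 = 1.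
Proof.
rewrite coefD coef_poly; have := ht (ltn_ord i).
case: (eqVneq (t i) m.+1) => [->|nti hti]; first by exists 1; rewrite subnn add0r coef1 mulr1.
have lti : (t i < m.+1)%N by rewrite ltn_neqAle nti.
rewrite subn_gt0 lti coef0 addr0.
exists (iota (tofrac (x_ (w i) (inord (t i + 0))))^-1).
by rewrite -rmorphM mulVf ?rmorph1 // tofrac_eq0 -msupp_eq0 msuppX.
Qed.

Definition psi : {rmorphism R -> S} :=
  jet_eval (iota \o @tofrac R \o @mpolyC _ k) (fun i j =>
    if insub (i : nat) is Some i' then (root_poly i' * unit_poly i')`_j
    else iotaR (x_ i j)).

Arguments psi : simpl never.

Lemma psi_X_lt i j : psi (x_ (w i) j) = (root_poly i * unit_poly i)`_j.
Proof. by rewrite jet_evalX (_ : insub _ = Some i) //; apply: (valK i). Qed.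

Lemma psi_X_ge (i : 'I_n) j : (r <= i)%N -> psi (x_ i j) = iotaR (x_ i j).
Proof. by move=> hi; rewrite jet_evalX insubN // -leqNgt. Qed.

(** Up to [X^m] this is the definition of [psi]. Higher terms are absent, unless [t i = m + 1]: then
    [root_poly i] is monic of degree [m + 1], matching the extra term of [jet_poly]. *)
Lemma psi_jet_poly i : map_poly psi (jet_poly k m hrn t i) = root_poly i * unit_poly i.
Proof.
apply/polyP => j; rewrite coef_map /=; have [hj|hj] := ltnP j m.+1.
  by rewrite (coef_jet_poly k hrn t i (Ordinal hj)) psi_X_lt.
rewrite coefD coef_poly ltnNge hj /= add0r /unit_poly.
case: (eqVneq (t i) m.+1) => [ti|nti].
  rewrite ti subnn coefXn rmorph_nat.
  have -> : \poly_(j0 < 0) iotaR (x_ (w i) (inord (m.+1 + j0))) = 0.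
    by apply/polyP => l; rewrite coef_poly coef0.
  rewrite add0r mulr1; case: eqP => [->|/eqP hjm].
    by have /monicP := monic_root_poly i; rewrite lead_coefE size_root_poly ti => ->.
  by rewrite nth_default // size_root_poly ti ltn_neqAle eq_sym hjm.
rewrite coef0 rmorph0 addr0 nth_default //; apply: leq_trans hj.
apply: leq_trans (size_polyMleq _ _) _; rewrite size_root_poly addSn /=.
by rewrite -[m.+1 in X in (_ <= X)%N](subnKC (ht (ltn_ord i))) leq_add2l size_poly.
Qed.

Lemma psi_gjet d : (d < m.+1)%N -> psi (gjet k n m r d) = 0.
Proof.
move=> hd; rewrite -(coef_prod_gjet (coef_jet_poly k hrn t)) // -coef_map rmorph_prod.
rewrite (eq_bigr _ (fun i _ => psi_jet_poly i)) big_split /= prod_root_poly.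
by rewrite coefXnM hd.
Qed.

Lemma root_nilpotent (i : 'I_r) (l : 'I_(t i)) : y l ^+ m.+1 = 0.
Proof.
have /(congr1 (fun p => p.[y l])) := prod_root_poly.
rewrite hornerXn => <-; rewrite horner_prod (bigD1 i) //= /root_poly horner_prod.
by rewrite (bigD1 l) //= hornerXsubC subrr !mul0r.
Qed.

(** Modulo the roots, [root_poly i] is [X^(t i)] and shifts the coefficients of [unit_poly i] by
    [t i], so [psi] sends [x_i^(j)] to zero for [j < t i] and to its own image under [iotaR]
    otherwise. *)
Lemma psi_congr (I : S -> Prop) : sat_ideal (eq 1) I ->
    (forall (i : 'I_r) (l : 'I_(t i)), I (y l)) ->
  forall p, I (psi p - iotaR (kill_P k n m r t p)).
Proof.
move=> hI hy; apply: (jet_rmorph_congr (f := psi) (g := iota \o @tofrac R \o kill_P k n m r t)) => //.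
  move=> c; rewrite jet_evalC -[X in _ - X]/(iotaR (kill_P k n m r t c%:MP)).
  by rewrite jet_evalC subrr; apply: sat_ideal0 hI.
move=> i j; rewrite -[X in _ - X]/(iotaR (kill_P k n m r t (x_ i j))) [kill_P k n m r t _]jet_evalX.
have [hi|hi] := ltnP i r; last by rewrite psi_X_ge // subrr; apply: sat_ideal0 hI.
rewrite (_ : i = w (Ordinal hi)); last exact: val_inj.
rewrite psi_X_lt /=; set i' := Ordinal hi.
have wI : forall j, I ((root_poly i')`_j - ('X^(t i'))`_j).
  move=> l; have -> : 'X^(t i') = \prod_(l < t i') 'X :> {poly S}.
    by rewrite prodr_const card_ord.
  apply: (prod_congr_coef _ hI (N := l.+1)) => // i0 l0 _.
  rewrite coefB addrAC subrr add0r coefC; case: eqP => _; last by rewrite oppr0; apply: sat_ideal0 hI.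
  by apply: (sat_idealN hI).
have : I ((root_poly i' * unit_poly i')`_j - ('X^(t i') * unit_poly i')`_j).
  rewrite -coefB -mulrBl coefM; apply: (ideal_sum _ hI) => l _.
  by apply: (sat_idealMr _ hI); rewrite coefB.
congr (I (_ - _)); rewrite coefXnM; case: ltnP => hj; first by rewrite /iotaR !rmorph0.
have hjt : (j - t i' < m.+1 - t i')%N by rewrite -(ltn_add2r (t i')) !subnK ?ltn_ord // ltnW ?ltn_ord // (leq_ltn_trans hj).
rewrite coefD coef_poly hjt.
rewrite subnKC // inord_val; case: eqP => [e|]; last by rewrite coef0 addr0.
by move: hj; rewrite e leqNgt ltn_ord.
Qed.

(** The roots are nilpotent, so [psi s] differs by a nilpotent from the image of [kill_P s], which
    is nonzero in the fraction field. *)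
Lemma psi_inv s : ~ Pjet r t s -> exists v, v * psi s = 1.
Proof.
move=> hs; have [|N hN] := psi_congr (nilpotent_ideal S) _ s.
  by move=> i l; exists m.+1; apply: root_nilpotent.
apply: (unit_add_nilpotent (v := iota (tofrac (kill_P k n m r t s))^-1)) hN.
rewrite -rmorphM mulVf ?rmorph1 // tofrac_eq0.
by apply/PjetP.
Qed.

(** The low coefficients of [root_poly i * unit_poly i] are in [K]; cancelling the unit factor
    leaves those of [root_poly i], as [reach_roots] requires. *)
Lemma reach_psi_Pjet K : sat_ideal (eq 1) K -> (forall p, Pjet r t p -> K (psi p)) ->
  reach (eq 1) Q K (\prod_(i < r) (t i)`!).
Proof.
move=> hK hP; apply: reach_roots => // i j hj.
have [v vU] := unit_poly0_inv i.
apply: (ideal_coef_divr hK vU) hj => {}j hj.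
have hjm : (j < m.+1)%N by apply: leq_trans hj (ht (ltn_ord i)).
rewrite -(psi_X_lt i (Ordinal hjm)); apply: hP; apply: Pjet_var => //=.
Qed.

Lemma reach_jet_transfer N :
  reach (fun s => ~ Pjet r t s) (@Pjet k n m r t)
    (saturation (fun s => ~ Pjet r t s) (@Jjet k n m r)) N ->
  reach (eq 1) Q (eq 0) (N * \prod_(i < r) (t i)`!).
Proof.
apply: (reach_transfer psi_inv reach_psi_Pjet) => x [s [hs hx]].
(* [psi] kills [Jjet], and cancelling the unit [psi s] extends this to the saturation. *)
have [v vs] := psi_inv hs.
have h0 : psi (s * x) = 0.
  move: (s * x) hx; apply: (@in_ideal_gen_min R _ _ (eq 1) (fun p => psi p = 0)).
    split=> [|a b ha hb|c a ha|s' a <-]; rewrite ?rmorph0 ?mul1r //.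
      by rewrite rmorphD ha hb addr0.
    by rewrite rmorphM ha mulr0.
  by move=> d; apply: psi_gjet.
by rewrite -[psi x]mul1r -vs -mulrA -rmorphM h0 mulr0.
Qed.

End LowerBound.

(** * Comparison of the two bounds *)

Lemma leq_reach_jet (k : fieldType) (n m r : nat) (hrn : (r <= n)%N) (t : nat -> nat) N :
    (forall i, (i < r)%N -> (t i <= m.+1)%N) -> (\sum_(i < r) t i)%N = m.+1 ->
  reach (fun s => ~ Pjet r t s) (@Pjet k n m r t)
    (saturation (fun s => ~ Pjet r t s) (@Jjet k n m r)) N ->
  ((m.+1)`! <= N * \prod_(i < r) (t i)`!)%N.
Proof.
move=> ht hsum hN; pose K := {fraction {mpoly k[n * m.+1]}}.
have [S [iota [y0 [B [b [fy cB bfree bgen]]]]]] :=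
  @splitting_ring m.+1 K 'X^(m.+1) (monicXn _ _) (size_polyXn _ _).
(* [D] indexes the [m + 1] roots of the splitting algebra by blocks of sizes [t i]. *)
pose D := {i : 'I_r & 'I_(t i)}.
have cD : #|{: D}| = m.+1.
  rewrite card_tagged sumnE big_map big_enum /= -[RHS]hsum.
  by apply: eq_bigr => i _; rewrite card_ord.
pose e (x : D) : 'I_m.+1 := cast_ord cD (enum_rank x).
have e_bij : bijective e.
  by exists (fun j => enum_val (cast_ord (esym cD) j)) => x;
     rewrite /e ?cast_ordK ?enum_rankK ?enum_valK ?cast_ordKV.
pose y (i : 'I_r) (l : 'I_(t i)) := y0 (e (Tagged (fun i : 'I_r => 'I_(t i)) l)).
rewrite -cB; apply: (free_leq_reach (iota := iota) (P := fun z => exists c : forall i : 'I_r, 'I_(t i) -> S,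
   z = \sum_i \sum_l c i l * y i l)) bfree _.
- move=> s; have [c [z ->]] := bgen s; exists c, (\sum_i z i * y0 i); split=> //.
  exists (fun i l => z (e (Tagged (fun i : 'I_r => 'I_(t i)) l))).
  rewrite sig_big_dep /= (reindex e) /=; last exact: onW_bij.
  by apply: eq_bigr => -[].
- apply: (reach_jet_transfer hrn ht iota _ hN).
  rewrite sig_big_dep /= -(map_polyXn iota) fy [RHS](reindex e) /=; last exact: onW_bij.
  by apply: eq_bigr => -[].
Qed.

Theorem mainTheorem1 (k : closedFieldType) (hk : [pchar k] =i pred0)
  (n m r : nat) (hr1 : (1 <= r)%N) (hrn : (r <= n)%N)
  (t : nat -> nat)
  (ht : forall i, (i < r)%N -> (t i <= m.+1)%N)
  (hsum : (\sum_(i < r) t i)%N = m.+1) :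
  loc_length (fun s : Rjet k n m => ~ Pjet r t s) (@Jjet k n m r)
    ((m.+1)`! %/ \prod_(i < r) (t i)`!)%N.
Proof.
have prod_gt0 : (0 < \prod_(i < r) (t i)`!)%N by apply: prodn_gt0 => i; apply: fact_gt0.
have [N [hN e]] := reach_jet k hrn ht hsum.
rewrite -e mulnK //; apply: loc_length_reach hN _.
- exact: notPjet1.
- exact: notPjetM.
- by move=> s; case: (PjetP r t s); [right | left].
- exact: in_ideal_gen_ideal.
- by move=> N' /(leq_reach_jet hrn ht hsum); rewrite -e leq_pmul2r.
Qed.
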